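(* Let $B=(b_k)_{k\ge 0}$ be a sequence of positive integers (not necessarily increasing) such that (i) for each $k$, $3^k$ is the largest power of $3$ dividing $b_k$, and (ii) $b_k=3^k$ for all sufficiently large $k$. Then $B$ is a valid basis, i.e. there exists a Stanley sequence $S(A)$ that is basic with basis $B$.
   Context: A set of integers is 3-free if it contains no three distinct terms in arithmetic progression. For a finite 3-free set $A=\{a_0<\cdots<a_k\}$ of nonnegative integers, the Stanley sequence $S(A)=(a_n)_{n\ge 0}$ is defined greedily: once $a_0<\cdots<a_n$ (with $n\ge k$) are defined, $a_{n+1}$ is the smallest integer greater than $a_n$ such that $\{a_0,\ldots,a_{n+1}\}$ is 3-free. $S(A)$ is also regarded as a set. A Stanley sequence $S(A)$ is basic with basis $B=(b_k)_{k\ge0}$ if there is a constant $\alpha\in\mathbb{N}$ (positive integer) such that $b_k=\alpha\cdot 3^k$ for all sufficiently large $k$, and $$S(A)=\Big\{\sum_k\delta_kb_k\ \Big|\ \delta_k\in\{0,1\},\ \delta_k\neq0\text{ for only finitely many }k\Big\},$$ where these sums are all distinct. *)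

(* Defs.v *)
From mathcomp Require Import all_boot.
From mathcomp Require Import finmap.

Set Implicit Arguments.
Unset Strict Implicit.
Unset Printing Implicit Defensive.

Definition three_free (X : {pred nat}) : Prop :=
  forall x y z, x \in X -> y \in X -> z \in X -> x < y -> y < z ->
    x + z <> y.*2.

(* A finite set {a_0 < ... < a_k} is represented by its increasing
   enumeration; it is nonempty, so that size A = k + 1. *)
Definition stanley_seed (A : seq nat) : Prop :=
  [/\ A != [::], sorted ltn A & three_free (mem A)].

Definition stanley_candidate (a : nat -> nat) (n m : nat) : Prop :=
  a n < m /\ three_free (mem (rcons (mkseq a n.+1) m)).

(* The condition size A <= n.+1 is n >= k. The relation determines a
   uniquely from A. *)
Definition is_stanley (A : seq nat) (a : nat -> nat) : Prop :=
  [/\ stanley_seed A,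
      forall n, n < size A -> a n = nth 0 A n
    & forall n, size A <= n.+1 ->
        stanley_candidate a n (a n.+1) /\
        forall m, stanley_candidate a n m -> a n.+1 <= m].

(* A finitely supported 0/1 sequence (delta_k) is represented by the finite
   set D = {k | delta_k = 1}. *)
Definition basis_sum (b : nat -> nat) (D : {fset nat}) : nat :=
  \sum_(k <- D) b k.

Definition is_basic (a b : nat -> nat) : Prop :=
  [/\ exists2 alpha, 0 < alpha &
        exists K, forall k, K <= k -> b k = alpha * 3 ^ k,
      forall x, (exists n, a n = x) <-> (exists D, basis_sum b D = x)
    & injective (basis_sum b)].

(* Main.v *)
Require Import Defs.
From mathcomp Require Import all_boot.
From mathcomp Require Import finmap.
From mathcomp Require Import zify.

(** Write [b k = 3 ^ k * u k] with [u k] prime to 3, and let [S] be the set of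
    the sums of finitely many distinct terms of [b].

    Sums of the [b k] with coefficients in {0, 1, 2} behave like base 3
    expansions, since the lowest coefficient is determined modulo 3. Two facts
    about [S] follow.
    - If [x + z = 2 y] in [S], comparing lowest coefficients modulo 3 gives
      [d + f = 2 e] modulo 3 for bits [d], [e], [f], which forces
      [d = e = f]; one then divides by 3 and repeats. So [x = y = z] with the
      same summands ([basis_sum_midpoint]): [S] is 3-free and the sums are
      distinct.
    - Every large [m] is a sum of the [b k] with coefficients in {0, 1, 2}
      ([ternary_expansion]). If [m] is not in [S], some coefficient is 2; let
      [y] add the [b k] of nonzero coefficient and [x] those of coefficient 1.
      Then [m = 2 y - x] with [x < y] in [S], so that [m] completes a
      progression ([covered_of_large]).

    Hence the increasing enumeration of [S] is greedy from some point on, and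
    is the Stanley sequence of any of its sufficiently long initial segments
    ([is_stanley_enumeration]). *)

(** * Enumerations of infinite sets of natural numbers *)

Lemma increasing_enumeration (P : pred nat) :
  (forall n, exists m, (n <= m) && P m) ->
  exists2 a : nat -> nat, (forall n, a n < a n.+1) &
    forall x, (exists n, a n = x) <-> P x.
Proof.
move=> P_unbounded; pose next n := ex_minn (P_unbounded n).
have nextP n : [/\ n <= next n, P (next n) &
    forall m, n <= m -> P m -> next n <= m].
  rewrite /next; case: ex_minnP => k /andP[n_k Pk] k_min; split=> // m nm Pm.
  by apply: k_min; rewrite nm.
pose a n := iter n (fun x => next x.+1) (next 0).
have aS n : a n.+1 = next (a n).+1 by [].
have lt_a n : a n < a n.+1 by rewrite aS; case: (nextP (a n).+1).
have ge_a n : n <= a n by elim: n => // n IH; apply: leq_ltn_trans (lt_a n).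
exists a => // x; split=> [[n <-] | Px].
  by case: n => [|n]; [case: (nextP 0) | rewrite aS; case: (nextP (a n).+1)].
have hit_or_below n : (exists k, a k = x) \/ a n <= x.
  elim: n => [|n [hit|]]; [|by left|].
    by right; case: (nextP 0) => _ _; apply.
  rewrite leq_eqVlt => /predU1P[|lt_x]; first by left; exists n.
  by right; rewrite aS; case: (nextP (a n).+1) => _ _; apply.
by case: (hit_or_below x.+1) => // le_x; have := ge_a x.+1; lia.
Qed.

(** The seed has to reach [C]: only above [C] are the gaps of [P] known to be
    forced by progressions. An initial segment with [C.+1] terms does, because
    [a C >= C]. *)
Lemma is_stanley_enumeration (P : pred nat) (a : nat -> nat) (C : nat) :
    three_free P -> (forall n, a n < a n.+1) ->
    (forall x, (exists n, a n = x) <-> P x) ->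
    (forall m, C <= m -> ~~ P m ->
       exists x y, [/\ P x, P y, x < y, y < m & x + m = y.*2]) ->
  is_stanley (mkseq a C.+1) a.
Proof.
move=> P_free lt_a aP covered.
have a_le : {mono a : m n / m <= n}.
  exact: leq_mono (homo_ltn ltn_trans lt_a).
have a_mono : {mono a : m n / m < n} by apply: leqW_mono.
have ge_a n : n <= a n by elim: n => // n IH; apply: leq_ltn_trans (lt_a n).
have Pa n : P (a n) by apply/aP; exists n.
have free_sub (s : seq nat) : all P s -> three_free (mem s).
  by move=> /allP sP x y z /sP Px /sP Py /sP Pz; apply: P_free.
have prefix_P n : all P (mkseq a n) by apply/allP=> x /mapP[k _ ->].
split; first split.
- by [].
- rewrite sorted_map; apply: sub_sorted (iota_ltn_sorted 0 _) => m n.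
  by rewrite /= a_mono.
- exact/free_sub/prefix_P.
- by move=> n; rewrite size_mkseq => lt_n; rewrite nth_mkseq.
- move=> n; rewrite size_mkseq ltnS => C_n; split.
    split; first exact: lt_a.
    by apply: free_sub; rewrite all_rcons Pa; apply: prefix_P.
  move=> m [lt_m m_free].
  have [/aP[k m_k] | notPm] := boolP (P m).
    by move: lt_m; rewrite -m_k a_mono a_le.
  have C_m : C <= m by have := ge_a n; lia.
  rewrite leqNgt; apply/negP => m_lt.
  have mem_prefix x : P x -> x < m -> x \in rcons (mkseq a n.+1) m.
    move=> /aP[k <-] lt_km; rewrite mem_rcons inE; apply/orP; right.
    by apply: map_f; rewrite mem_iota /= add0n -a_mono; apply: ltn_trans m_lt.
  have [x [y [Px Py x_y y_m]]] := covered m C_m notPm.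
  apply: (m_free x y m) => //;
    try by apply: mem_prefix => //; apply: ltn_trans y_m.
  by rewrite mem_rcons mem_head.
Qed.

(** * Finite subset sums as sums over initial segments *)

Lemma basis_sum_ord (b : nat -> nat) (D : {fset nat}) (N : nat) :
    (forall k, k \in D -> k < N) ->
  basis_sum b D = \sum_(k < N) (val k \in D) * b k.
Proof.
move=> D_lt; rewrite -(big_mkord xpredT (fun k => (k \in D) * b k)).
rewrite (eq_bigr (fun k => if k \in D then b k else 0)); last first.
  by move=> k _; case: (k \in D); rewrite ?mul1n.
rewrite -big_mkcond -big_filter; apply: perm_big.
apply: uniq_perm; rewrite ?filter_uniq ?iota_uniq ?fset_uniq // => k.
by rewrite mem_filter mem_index_iota; case: (boolP (k \in D)) => // /D_lt ->.
Qed.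

Lemma sum_ord_basis_sum (b : nat -> nat) (p : pred nat) (N : nat) :
  exists D : {fset nat}, basis_sum b D = \sum_(k < N) p k * b k.
Proof.
exists (seq_fset tt [seq k <- iota 0 N | p k]).
rewrite (@basis_sum_ord _ _ N).
  apply: eq_bigr => k _.
  by rewrite seq_fsetE mem_filter mem_iota add0n ltn_ord !andbT.
by move=> k; rewrite seq_fsetE mem_filter mem_iota => /andP[].
Qed.

Lemma fset_nat_bounded (D : {fset nat}) :
  exists N, forall k, k \in D -> k < N.
Proof.
exists (\max_(k <- D) k).+1 => k kD.
by rewrite ltnS; apply: (@leq_bigmax_seq _ _ xpredT id).
Qed.

(** * Coefficients modulo 3 *)

(** If [u] is at most half of [q], any of the digits 0, 1, 2 can be subtracted;
    if [u = 1], the digit is [q %% 3], which is at most [q]. *)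
Lemma ternary_digit (u q : nat) : ~~ (3 %| u) -> 2 * u <= q \/ u = 1 ->
  exists d r, d <= 2 /\ q = d * u + 3 * r.
Proof.
move=> u3 small_u; have [q0 | q0] := eqVneq (q %% 3) 0.
  by exists 0, (q %/ 3); lia.
have [uq1 | uq1] := eqVneq (q %% 3) (u %% 3).
  by exists 1, ((q - u) %/ 3); lia.
by exists 2, ((q - 2 * u) %/ 3); lia.
Qed.

(** [d + f - 2 e] lies between -2 and 2, so it vanishes as soon as 3 divides
    it; and [d + f = 2 e] makes both bits equal to [e]. *)
Lemma midpoint_bits_mod3 (u X Y Z : nat) (d e f : bool) : ~~ (3 %| u) ->
    d * u + 3 * X + (f * u + 3 * Z) = (e * u + 3 * Y).*2 ->
  d = e /\ f = e.
Proof. by case: d; case: e; case: f => //; lia. Qed.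

(** Splitting off the lowest coefficient leaves a sum of the same form for the
    shifted sequence of units; the induction therefore needs the units to be
    arbitrary. *)
Lemma midpoint_bits (u : nat -> nat) (d e f : pred nat) (N : nat) :
    (forall k, ~~ (3 %| u k)) ->
    \sum_(k < N) d k * (3 ^ k * u k) + \sum_(k < N) f k * (3 ^ k * u k)
      = (\sum_(k < N) e k * (3 ^ k * u k)).*2 ->
  forall k, k < N -> d k = e k /\ f k = e k.
Proof.
elim: N u d e f => // N IH u d e f u3.
have split0 (c : pred nat) : \sum_(k < N.+1) c k * (3 ^ k * u k) =
    c 0 * u 0 + 3 * \sum_(k < N) c k.+1 * (3 ^ k * u k.+1).
  rewrite big_ord_recl expn0 mul1n big_distrr; congr (_ + _).
  by apply: eq_bigr => k _; rewrite /= /bump /= add1n expnS; lia.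
rewrite !split0 => sums_eq.
have [d0 f0] := @midpoint_bits_mod3 _ _ _ _ _ _ _ (u3 0) sums_eq.
case=> [//|k] lt_k.
apply: (IH (u \o succn) (d \o succn) (e \o succn) (f \o succn)) lt_k => [j|].
  exact: u3.
by move: sums_eq; rewrite d0 f0 /=; lia.
Qed.

Section ThreeAdicBasisSums.

Variable b : nat -> nat.
Hypothesis b_gt0 : forall k, 0 < b k.
Hypothesis b_part3 : forall k, (b k)`_3 = 3 ^ k.

Lemma basis_cofactor_prime3 k : ~~ (3 %| (b k)`_3^').
Proof. by rewrite -p'natE // part_pnat. Qed.

Lemma basis_cofactor k : b k = 3 ^ k * (b k)`_3^'.
Proof. by rewrite -b_part3 partnC. Qed.

Lemma ltn_basis k : k < b k.
Proof.
rewrite basis_cofactor; apply: leq_trans (ltn_expl k _) (leq_pmulr _ _) => //.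
Qed.

Lemma basis_sum_midpoint (D E F : {fset nat}) :
  basis_sum b D + basis_sum b F = (basis_sum b E).*2 -> D = E.
Proof.
have [N lt_N] := fset_nat_bounded (D `|` E `|` F)%fset.
have [DN EN FN] : [/\ forall k, k \in D -> k < N, forall k, k \in E -> k < N
    & forall k, k \in F -> k < N].
  by split=> k k_in; apply: lt_N; rewrite !inE k_in ?orbT.
rewrite (basis_sum_ord _ _ _ DN) (basis_sum_ord _ _ _ EN).
rewrite (basis_sum_ord _ _ _ FN).
have coef (G : {fset nat}) : \sum_(k < N) (val k \in G) * b k =
    \sum_(k < N) mem G k * (3 ^ k * (b k)`_3^').
  by apply: eq_bigr => k _; rewrite -basis_cofactor.
rewrite !coef => /(midpoint_bits _ _ _ _ _ basis_cofactor_prime3) bits_eq.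
apply/fsetP => k; have [/bits_eq[]//|N_k] := ltnP k N.
have out (G : {fset nat}) : (forall k, k \in G -> k < N) -> (k \in G) = false.
  by move=> GN; apply/negP => /GN; rewrite ltnNge N_k.
by rewrite !out.
Qed.

Lemma basis_sum_inj : injective (basis_sum b).
Proof.
by move=> D E sum_eq; apply: (@basis_sum_midpoint D E E); rewrite sum_eq addnn.
Qed.

(** The set [S] of all basis sums, as a boolean predicate: a sum equal to [x]
    only uses indices at most [x], because [k < b k]. *)
Definition is_basis_sum : pred nat :=
  fun x => has (fun D => basis_sum b D == x)
             (fpowerset (seq_fset tt (iota 0 x.+1))).

Lemma is_basis_sumP x : reflect (exists D, basis_sum b D = x) (is_basis_sum x).
Proof.
apply: (iffP hasP) => [[D _ /eqP]|[D sumD]]; first by exists D.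
exists D; last exact/eqP.
rewrite fpowersetE; apply/fsubsetP => k kD.
rewrite seq_fsetE mem_iota /= add0n ltnS -sumD /basis_sum.
apply: leq_trans (ltnW (ltn_basis k)) _.
by rewrite (big_fsetD1 k) //= leq_addr.
Qed.

Lemma is_basis_sum_unbounded n : exists m, (n <= m) && is_basis_sum m.
Proof.
exists (b n); rewrite (ltnW (ltn_basis n)).
by apply/is_basis_sumP; exists [fset n]%fset; rewrite /basis_sum big_seq_fset1.
Qed.

Lemma is_basis_sum_three_free : three_free is_basis_sum.
Proof.
move=> x y z /is_basis_sumP[D <-] /is_basis_sumP[E <-] /is_basis_sumP[F <-].
by move=> lt_DE _ /basis_sum_midpoint DE; rewrite DE ltnn in lt_DE.
Qed.

(** * Ternary expansions of large numbers *)

Variable K : nat.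
Hypothesis b_eventually : forall k, K <= k -> b k = 3 ^ k.

Let C := 2 * \sum_(k < K) b k.

(** While [n < K], the bound [C <= m] keeps the remainder [q] large enough for
    the digit at [n] to be subtracted, whatever the size of [b n]; from [K] on
    the digits are the ordinary base 3 digits of the remainder left at [K]. *)
Lemma ternary_partial_expansion m n : C <= m ->
  exists (c : nat -> nat) q, (forall k, c k <= 2) /\
    m = \sum_(k < n) c k * b k + 3 ^ n * q.
Proof.
move=> C_m; elim: n => [|n [c [q [c_le m_eq]]]].
  by exists (fun=> 0), m; rewrite big_ord0 mul1n.
have := basis_cofactor n; have := basis_cofactor_prime3 n.
move: (b n)`_3^' => u u3 bn.
have pos : 0 < 3 ^ n by rewrite expn_gt0.
have q_large : 2 * u <= q \/ u = 1.
  have [K_n | n_K] := leqP K n.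
    right; apply/eqP; rewrite -(eqn_pmul2l pos) muln1 -bn.
    by rewrite b_eventually.
  left; rewrite -(leq_pmul2l pos).
  have : \sum_(k < n.+1) b k <= \sum_(k < K) b k.
    rewrite -!(big_mkord xpredT b) (big_cat_nat _ n_K) //=.
    exact: leq_addr.
  have : \sum_(k < n) c k * b k <= 2 * \sum_(k < n) b k.
    by rewrite big_distrr leq_sum // => k _; rewrite leq_mul2r c_le orbT.
  rewrite big_ord_recr /= bn; move: C_m m_eq; rewrite /C.
  have -> : 3 ^ n * (2 * u) = 2 * (3 ^ n * u) by lia.
  move: (\sum_(k < n) b k) (\sum_(k < K) b k) => s t.
  move: (\sum_(k < n) c k * b k) (3 ^ n * u) (3 ^ n * q) => r v w.
  lia.
have [d [r [d_le q_eq]]] := ternary_digit _ _ u3 q_large.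
exists (fun k => if k == n then d else c k), r; split.
  by move=> k; case: eqP.
rewrite big_ord_recr /= eqxx m_eq q_eq bn expnS.
rewrite [in RHS](eq_bigr (fun k : 'I_n => c k * b k)).
  by rewrite mulnDr addnA !(mulnCA (3 ^ n)) -mulnA.
by move=> k _; rewrite ltn_eqF.
Qed.

Lemma ternary_expansion m : C <= m ->
  exists c : nat -> nat, (forall k, c k <= 2) /\ m = \sum_(k < m) c k * b k.
Proof.
move=> /(@ternary_partial_expansion m m)[c [q [c_le m_eq]]].
exists c; split=> //.
(* The remainder is a multiple of 3 ^ m > m, hence 0. *)
have lt_m : m < 3 ^ m by apply: ltn_expl.
by case: q m_eq => [|q]; [rewrite muln0 addn0 | rewrite mulnS; lia].
Qed.

Lemma covered_of_large m : C <= m -> ~~ is_basis_sum m ->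
  exists x y,
    [/\ is_basis_sum x, is_basis_sum y, x < y, y < m & x + m = y.*2].
Proof.
move=> /ternary_expansion[c [c_le m_eq]] notS.
pose sum p := \sum_(k < m) (p (c k) : bool) * b k.
have sumS p : is_basis_sum (sum p).
  by apply/is_basis_sumP/(sum_ord_basis_sum b (p \o c)).
pose twos := sum (pred1 2); pose ones := sum (pred1 1).
have m_split : m = ones + 2 * twos.
  rewrite [LHS]m_eq /twos /ones /sum big_distrr -big_split.
  apply: eq_bigr => k _ /=.
  by move: (c_le k); case: (c k) => [|[|[|]]] //= _; lia.
have y_split : sum (predC1 0) = ones + twos.
  rewrite /twos /ones /sum -big_split; apply: eq_bigr => k _ /=.
  by move: (c_le k); case: (c k) => [|[|[|]]] //= _; lia.
have twos_gt0 : 0 < twos.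
  rewrite lt0n; apply: contra notS => /eqP twos0.
  by rewrite m_split twos0 muln0 addn0; apply: sumS.
exists ones, (sum (predC1 0)); split; try exact: sumS; lia.
Qed.

End ThreeAdicBasisSums.

(** * Valid bases *)

Theorem theorem4p4 (b : nat -> nat)
  (b_gt0 : forall k : nat, 0 < b k)
  (b_part3 : forall k : nat, (b k)`_3 = 3 ^ k)
  (b_eventually : exists K : nat, forall k : nat, K <= k -> b k = 3 ^ k) :
  exists (A : seq nat) (a : nat -> nat), is_stanley A a /\ is_basic a b.
Proof.
have [K bK] := b_eventually.
have [a lt_a aP] :=
  increasing_enumeration _ (is_basis_sum_unbounded _ b_gt0 b_part3).
exists (mkseq a (2 * \sum_(k < K) b k).+1), a; split.
  apply: (is_stanley_enumeration (is_basis_sum b)) => //.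
    exact: is_basis_sum_three_free.
  exact: covered_of_large.
split; last exact: basis_sum_inj.
  by exists 1 => //; exists K => k /bK ->; rewrite mul1n.
by move=> x; apply: (iff_trans (aP x)); split=> /is_basis_sumP; apply.
Qed.
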